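(* Let $V$ be a finite-dimensional real vector space and let $\mathfrak g\subset\mathfrak{gl}(V)$ be a Lie subalgebra. Suppose $V=V_1\oplus V_2$, where $V_1$ and $V_2$ are $\mathfrak g$-invariant subspaces such that $V_1$ and $V_2$ are both faithful representations of $\mathfrak g$. Then $$\underline{\mathfrak g}=\big\langle R(x,y')\;\big|\;x\in V_1,\ y'\in V_2,\ R\in k(\mathfrak g)\big\rangle .$$
   Context: $\langle\cdot\rangle$ denotes linear span. For a Lie subalgebra $\mathfrak g\subset\mathfrak{gl}(V)$, the space of formal curvature tensors is $$\mathcal K(\mathfrak g)=\{R\in (V^*\wedge V^* )\otimes\mathfrak g \mid R(x,y)z+R(y,z)x+R(z,x)y=0\ \text{for all } x,y,z\in V\},$$ and $\underline{\mathfrak g}=\langle R(x,y)\mid x,y\in V,\ R\in\mathcal K(\mathfrak g)\rangle$. When $V=V_1\oplus V_2$ with $V_1,V_2$ invariant under $\mathfrak g$, $$k(\mathfrak g)=\{R\in V_1^*\otimes V_2^*\otimes\mathfrak g\mid R(x,y')z'=R(x,z')y',\ R(x,y')t=R(t,y')x\ \text{for all } x,t\in V_1,\ y',z'\in V_2\}.$$ *)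

(* Defs.v *)
From HB Require Import structures.
From mathcomp Require Import all_boot all_order all_algebra.
From mathcomp Require Import boolp classical_sets.

Set Implicit Arguments.
Unset Strict Implicit.
Unset Printing Implicit Defensive.

Import GRing.Theory.
Local Open Scope classical_set_scope.
Local Open Scope ring_scope.

(* Linear span of a possibly infinite set: the union of the library spans of
   its finite families. *)
Definition lin_span (K : fieldType) (W : vectType K) (A : set W) : set W :=
  [set w | exists2 s : seq W, [set` s] `<=` A & w \in <<s>>%VS].

(* The composition of linear maps is used because 'End(V) only has a ring
   structure when V is nonzero. *)
Definition lie_bracket (K : fieldType) (V : vectType K) (f h : 'End(V)) :
  'End(V) := (f \o h)%VF - (h \o f)%VF.

Definition lie_subalgebra (K : fieldType) (V : vectType K)
    (g : {vspace 'End(V)}) : Prop :=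
  forall f h, f \in g -> h \in g -> lie_bracket f h \in g.

Definition invariant_subspace (K : fieldType) (V : vectType K)
    (g : {vspace 'End(V)}) (U : {vspace V}) : Prop :=
  forall f, f \in g -> (f @: U <= U)%VS.

(* Injectivity of the restriction map f |-> f|_U from g to gl(U). *)
Definition faithful_on (K : fieldType) (V : vectType K)
    (g : {vspace 'End(V)}) (U : {vspace V}) : Prop :=
  forall f h, f \in g -> h \in g -> {in U, f =1 h} -> f = h.

(* The endomorphism r(x, y) of V, for a g-valued bilinear map r in curried
   form. *)
Definition gval (K : fieldType) (V U W : vectType K) (g : {vspace 'End(V)})
    (r : 'Hom(U, 'Hom(W, subvs_of g))) (x : U) (y : W) : 'End(V) :=
  vsval (r x y : subvs_of g).

(* With V' the dual of V, an element of (V' /\ V') (x) g is a skew-symmetric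
   bilinear map V x V -> g. *)
Definition curvature_tensors (K : fieldType) (V : vectType K)
    (g : {vspace 'End(V)}) : set 'Hom(V, 'Hom(V, subvs_of g)) :=
  [set r : 'Hom(V, 'Hom(V, subvs_of g)) |
    (forall x y : V, gval r x y = - gval r y x) /\
    (forall x y z : V, gval r x y z + gval r y z x + gval r z x y = 0)].

Definition curvature_span (K : fieldType) (V : vectType K)
    (g : {vspace 'End(V)}) : set 'End(V) :=
  lin_span [set f : 'End(V) |
    exists2 r, @curvature_tensors K V g r & exists x y : V, f = gval r x y].

(* With Vi' the dual of Vi, an element of V1' (x) V2' (x) g is a bilinear map
   V1 x V2 -> g. *)
Definition mixed_tensors (K : fieldType) (V : vectType K)
    (g : {vspace 'End(V)}) (V1 V2 : {vspace V}) :
    set 'Hom(subvs_of V1, 'Hom(subvs_of V2, subvs_of g)) :=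
  [set r : 'Hom(subvs_of V1, 'Hom(subvs_of V2, subvs_of g)) |
    (forall (x : subvs_of V1) (y' z' : subvs_of V2),
        gval r x y' (vsval z') = gval r x z' (vsval y')) /\
    (forall (x t : subvs_of V1) (y' : subvs_of V2),
        gval r x y' (vsval t) = gval r t y' (vsval x))].

Definition mixed_span (K : fieldType) (V : vectType K)
    (g : {vspace 'End(V)}) (V1 V2 : {vspace V}) : set 'End(V) :=
  lin_span [set f : 'End(V) |
    exists2 r, @mixed_tensors K V g V1 V2 r &
      exists (x : subvs_of V1) (y' : subvs_of V2), f = gval r x y'].

(* Main.v *)
Require Import Defs.
From HB Require Import structures.
From mathcomp Require Import all_boot all_order all_algebra.
From mathcomp Require Import boolp classical_sets reals.

(** By the Bianchi identity on V1 x V1 x V2, R(x, y)z = -R(y, z)x - R(z, x)y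
    lies in V1 and in V2 for x, y in V1 and z in V2, so it is 0, and R(x, y) = 0
    because V2 is faithful; symmetrically R vanishes on V2 x V2.  What remains of
    the Bianchi identity are the two symmetry conditions defining k(g), so that
    R is determined by an element r of k(g) through
    R(x + x', y + y') = r(x, y') - r(y, x').  Conversely, this formula turns
    every r in k(g) into a curvature tensor. *)

Set Implicit Arguments.
Unset Strict Implicit.
Unset Printing Implicit Defensive.

Import GRing.Theory.
Local Open Scope classical_set_scope.
Local Open Scope ring_scope.

Section LinearSpan.
Variables (K : fieldType) (W : vectType K).
Implicit Types (A B : set W) (v w : W).

Lemma lin_span_gen A w : A w -> lin_span A w.
Proof.
move=> Aw; exists [:: w]; last by rewrite memv_span ?mem_head.
by move=> v /=; rewrite inE => /eqP->.
Qed.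

Lemma lin_span0 A : lin_span A 0.
Proof. by exists [::]; rewrite ?mem0v. Qed.

Lemma lin_spanZ A c w : lin_span A w -> lin_span A (c *: w).
Proof. by case=> s sA ws; exists s; rewrite ?memvZ. Qed.

Lemma lin_spanD A v w : lin_span A v -> lin_span A w -> lin_span A (v + w).
Proof.
case=> s sA vs [t tA wt]; exists (s ++ t); last first.
  by rewrite span_cat memv_add.
by move=> u /=; rewrite mem_cat => /orP[/sA|/tA].
Qed.

Lemma lin_spanB A v w : lin_span A v -> lin_span A w -> lin_span A (v - w).
Proof.
by move=> Av Aw; apply: lin_spanD => //; rewrite -scaleN1r; apply: lin_spanZ.
Qed.

(** Reduces an inclusion of spans to generators. Induction on the finite family peels off a multiple
    of its head, and [lin_span B] is closed under sums and scalings. *)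
Lemma lin_span_sub A B : A `<=` lin_span B -> lin_span A `<=` lin_span B.
Proof.
move=> AB w [s sA]; elim: s sA w => [|a s IHs] sA w.
  by rewrite span_nil memv0 => /eqP->; apply: lin_span0.
rewrite span_cons => /memv_addP[u /vlineP[c ->] [v vs ->]].
apply: lin_spanD; first by apply/lin_spanZ/AB/sA; rewrite /= mem_head.
by apply: IHs vs => x xs; apply: sA; rewrite /= in_cons [x \in s]xs orbT.
Qed.

End LinearSpan.

Section LinearMaps.
Variable K : fieldType.

Lemma linear_hom (U W : vectType K) (f : U -> W) :
  linear f -> exists h : 'Hom(U, W), h =1 f.
Proof.
move=> lin_f; pose lf := GRing.isLinear.Build K U W *:%R f lin_f.
pose F : {linear U -> W} := HB.pack f lf.
by exists (linfun F) => x; rewrite lfunE.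
Qed.

(** Choice selects a linear map [h x] for each [x]. Since [h x] has the values of [f x], linearity
    of [f] in its first argument makes [h] linear. *)
Lemma bilinear_hom (U1 U2 W : vectType K) (f : U1 -> U2 -> W) :
  (forall y, linear (f^~ y)) -> (forall x, linear (f x)) ->
  exists h : 'Hom(U1, 'Hom(U2, W)), forall x y, h x y = f x y.
Proof.
move=> linl linr; pose h x := projT1 (cid (linear_hom (linr x))).
have hE x : h x =1 f x by rewrite /h; case: cid.
have /linear_hom[H HE] : linear h.
  by move=> c x x'; apply/lfunP => y; rewrite !lfunE /= lfunE /= !hE linl.
by exists H => x y; rewrite HE hE.
Qed.

End LinearMaps.

(** The shape of the Bianchi sum in [mixed_extension]: each of the six terms occurs once with each
    sign. *)
Lemma cyclic_sum0 (M : zmodType) (a1 a2 a3 b1 b2 b3 : M) :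
  a1 + b1 - (a2 + b2) + (a3 + b2 - (a1 + b3)) + (a2 + b3 - (a3 + b1)) = 0.
Proof.
have subD (u v w z : M) : u + v - (w + z) = (u - w) + (v - z).
  by rewrite opprD addrACA.
rewrite !subD (addrACA (a1 - a2)) (addrACA (a1 - a2 + _)).
by rewrite [a1 - a2 + _]addrC !subrKA !subrr addr0.
Qed.

Section Curvature.
Variables (K : fieldType) (V : vectType K) (g : {vspace 'End(V)}).
Variables V1 V2 : {vspace V}.

Lemma gvalP (U W : vectType K) (r : 'Hom(U, 'Hom(W, subvs_of g))) x y :
  gval r x y \in g.
Proof. exact: subvsP. Qed.

Lemma gvalDl (U W : vectType K) (r : 'Hom(U, 'Hom(W, subvs_of g))) x x' y :
  gval r (x + x') y = gval r x y + gval r x' y.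
Proof. by rewrite /gval linearD add_lfunE linearD. Qed.

Lemma gvalDr (U W : vectType K) (r : 'Hom(U, 'Hom(W, subvs_of g))) x y y' :
  gval r x (y + y') = gval r x y + gval r x y'.
Proof. by rewrite /gval !linearD. Qed.

Hypothesis V12_full : (V1 + V2)%VS = fullv.
Hypothesis capV12 : (V1 :&: V2)%VS = 0%VS.

Lemma direct_decomposition (x : V) :
  exists (x1 : subvs_of V1) (x2 : subvs_of V2), x = vsval x1 + vsval x2.
Proof.
have /memv_addP[u uV1 [v vV2 ->]] : x \in (V1 + V2)%VS.
  by rewrite V12_full memvf.
by exists (vsproj V1 u), (vsproj V2 v); rewrite !vsprojK.
Qed.

Section Restriction.
Variable r : 'Hom(V, 'Hom(V, subvs_of g)).
Hypothesis curv_r : curvature_tensors r.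

Lemma curvature_diag0 (U U' : {vspace V}) x y :
  (U :&: U')%VS = 0%VS -> invariant_subspace g U -> invariant_subspace g U' ->
  faithful_on g U' -> x \in U -> y \in U -> gval r x y = 0.
Proof.
move=> UU' invU invU' faithU' xU yU; have [_ bianchi] := curv_r.
have im W (w a b : V) : invariant_subspace g W -> w \in W -> gval r a b w \in W.
  by move=> invW wW; apply: (subvP (invW _ (gvalP r a b))); apply: memv_img.
apply: faithU'; rewrite ?gvalP ?mem0v // => z zU'.
apply/eqP; rewrite zero_lfunE -memv0 -UU' memv_cap.
apply/andP; split; last exact: im.
(* Membership in [U'] is invariance applied to [z]. For [U], the Bianchi identity leaves only values
   at [x] and [y], which lie in [U]. *)
move/eqP: (bianchi x y z); rewrite -addrA addr_eq0 => /eqP->.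
by rewrite memvN memvD ?im.
Qed.

Lemma curvature_restriction :
  (forall x y, x \in V1 -> y \in V1 -> gval r x y = 0) ->
  (forall x y, x \in V2 -> y \in V2 -> gval r x y = 0) ->
  exists2 s : 'Hom(subvs_of V1, 'Hom(subvs_of V2, subvs_of g)),
    mixed_tensors s &
    forall (x : subvs_of V1) (y : subvs_of V2),
      gval s x y = gval r (vsval x) (vsval y).
Proof.
move=> r11 r22; have [skew bianchi] := curv_r.
have [||s sE] := @bilinear_hom K (subvs_of V1) (subvs_of V2) (subvs_of g)
    (fun x y => r (vsval x) (vsval y)).
- by move=> y c x x'; rewrite !linearP lfunE /= lfunE.
- by move=> x c y y'; rewrite !linearP.
have s_val x y : gval s x y = gval r (vsval x) (vsval y) by rewrite /gval sE.
exists s => //; split=> [x y z|x t y]; rewrite !s_val.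
  (* With [y] and [z] in [V2] the term R(y, z)x vanishes, and skew symmetry turns R(z, x)y into
     -R(x, z)y. *)
  have := bianchi (vsval x) (vsval y) (vsval z).
  rewrite (r22 (vsval y)) ?subvsP // zero_lfunE addr0.
  rewrite (skew (vsval z)) opp_lfunE.
  by move/eqP; rewrite subr_eq0 => /eqP.
(* Likewise R(t, x)y vanishes for [x] and [t] in [V1]. *)
have := bianchi (vsval x) (vsval y) (vsval t).
rewrite (r11 (vsval t)) ?subvsP // zero_lfunE addr0 (skew (vsval y)) opp_lfunE.
by move/eqP; rewrite subr_eq0 => /eqP.
Qed.

End Restriction.

Lemma mixed_extension (s : 'Hom(subvs_of V1, 'Hom(subvs_of V2, subvs_of g))) :
  mixed_tensors s ->
  exists2 r : 'Hom(V, 'Hom(V, subvs_of g)), curvature_tensors r &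
    forall (x : subvs_of V1) (y : subvs_of V2),
      gval r (vsval x) (vsval y) = gval s x y.
Proof.
case=> sym2 sym1.
(* [p1] and [p2] are the projections of the direct sum, with values in the subspaces taken as
   types. *)
pose p1 x := vsproj V1 (daddv_pi V1 V2 x).
pose p2 x := vsproj V2 (daddv_pi V2 V1 x).
have p1P : linear p1 by move=> c x y; rewrite /p1 !linearP.
have p2P : linear p2 by move=> c x y; rewrite /p2 !linearP.
have capV21 : (V2 :&: V1)%VS = 0%VS by rewrite capvC capV12.
have pE x : x = vsval (p1 x) + vsval (p2 x).
  rewrite /p1 /p2 !vsprojK ?memv_pi //.
  by rewrite daddv_pi_add ?capV12 // V12_full memvf.
have [||r rE] := @bilinear_hom K V V (subvs_of g)
    (fun x y => s (p1 x) (p2 y) - s (p1 y) (p2 x)).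
- move=> y c x x'; rewrite p1P p2P !linearP !lfunE /= lfunE /=.
  by rewrite scalerBr scalerN addrACA.
- move=> x c y y'; rewrite p1P p2P !linearP !lfunE /= lfunE /=.
  by rewrite scalerBr opprD addrACA.
have r_val x y : gval r x y = gval s (p1 x) (p2 y) - gval s (p1 y) (p2 x).
  by rewrite /gval rE linearB.
exists r; first split=> [x y|x y z].
- by rewrite !r_val opprB.
- rewrite !r_val !add_lfunE !opp_lfunE.
  (* Splitting the argument of each of the six endomorphisms gives twelve terms. [sym1] matches
     those evaluated on [V1] components in pairs of opposite sign, [sym2] those on [V2]
     components. *)
  have gval_split u v w : gval s (p1 u) (p2 v) w =
      gval s (p1 u) (p2 v) (vsval (p1 w)) + gval s (p1 u) (p2 v) (vsval (p2 w)).
    by rewrite -linearD -pE.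
  rewrite (gval_split x y z) (gval_split y x z) (gval_split y z x) (gval_split z y x).
  rewrite (gval_split z x y) (gval_split x z y).
  rewrite (sym1 (p1 z) (p1 x) (p2 y)) (sym1 (p1 z) (p1 y) (p2 x)).
  rewrite (sym1 (p1 x) (p1 y) (p2 z)) (sym2 (p1 x) (p2 z) (p2 y)).
  rewrite (sym2 (p1 y) (p2 z) (p2 x)) (sym2 (p1 z) (p2 y) (p2 x)).
  exact: cyclic_sum0.
move=> x y; rewrite r_val.
have p1x : p1 (vsval x) = x by rewrite /p1 daddv_pi_id ?capV12 ?subvsP ?vsvalK.
have p2y : p2 (vsval y) = y by rewrite /p2 daddv_pi_id ?subvsP ?vsvalK.
have p2x : p2 (vsval x) = 0.
  (* As [p1] fixes [x], cancelling [x] in x = p1 x + p2 x leaves p2 x = 0. *)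
  apply/subvs_inj/(addrI (vsval x)).
  by have := pE (vsval x); rewrite p1x => <-; rewrite linear0 addr0.
by rewrite p1x p2y p2x /gval !linear0 addr0.
Qed.

End Curvature.

Theorem proposition3 (R : realType) (V : vectType R) (g : {vspace 'End(V)})
    (V1 V2 : {vspace V}) :
  lie_subalgebra g ->
  (V1 + V2)%VS = fullv ->
  directv (V1 + V2)%VS ->
  invariant_subspace g V1 ->
  invariant_subspace g V2 ->
  faithful_on g V1 ->
  faithful_on g V2 ->
  curvature_span g = mixed_span g V1 V2.
Proof.
move=> _ full /directv_addP cap12 inv1 inv2 faith1 faith2.
rewrite eqEsubset; split; apply: lin_span_sub => _ [r Hr [x [y ->]]]; last first.
  (* A generator of the mixed span is a value of the extended tensor on [V1] x [V2]. *)
  have [s curv_s sE] := mixed_extension full cap12 Hr.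
  by apply: lin_span_gen; exists s => //; exists (vsval x), (vsval y).
have r11 u v : u \in V1 -> v \in V1 -> gval r u v = 0.
  exact: (curvature_diag0 Hr cap12).
have r22 u v : u \in V2 -> v \in V2 -> gval r u v = 0.
  by apply: (curvature_diag0 Hr _ inv2 inv1 faith1); rewrite capvC.
have [s mixed_s sE] := curvature_restriction Hr r11 r22.
have [x1 [x2 ->]] := direct_decomposition full x.
have [y1 [y2 ->]] := direct_decomposition full y.
(* Only the mixed terms survive: R(x, y) = R(x1, y2) + R(x2, y1) = s(x1, y2) - s(y1, x2). *)
rewrite gvalDl !gvalDr (r11 (vsval x1) (vsval y1)) ?subvsP //.
rewrite (r22 (vsval x2) (vsval y2)) ?subvsP // add0r addr0.
have [skew _] := Hr; rewrite (skew (vsval x2)) -!sE.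
by apply: lin_spanB; apply: lin_span_gen; exists s => //;
  [exists x1, y2 | exists y1, x2].
Qed.
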